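(* Let $k\in\{\mathbb{R},\mathbb{C}\}$. The category $\mathcal{B}c$ of (separated and non-separated) bornological vector spaces over $k$, furnished with bounded linear maps as morphisms, is quasi-abelian and integral.
   Context: A bornological vector space is a pair $(X,\mathcal{B}_X)$ where $X$ is a $k$-vector space and $\mathcal{B}_X$ is a convex bornology on $X$, i.e. a family of subsets of $X$ containing all singletons and closed under taking subsets, finite unions, multiplication by scalars $\lambda>0$, and absolutely convex hulls. A linear map $f\colon X\to Y$ is bounded if $f(B)\in\mathcal{B}_Y$ whenever $B\in\mathcal{B}_X$. An additive category is pre-abelian if every morphism has a kernel and a cokernel. A morphism is called ''a kernel'' (resp. ''a cokernel'') if it is the kernel (resp. cokernel) of some morphism. A class $\mathcal{X}$ of morphisms is stable under pullback if in any pullback square with $a\colon A\to B$, $b\colon A\to C$, $c\colon B\to D$, $d\colon C\to D$ and $c\circ a=d\circ b$, one has $a\in\mathcal{X}$ whenever $d\in\mathcal{X}$; stability under pushout is defined dually. A pre-abelian category is quasi-abelian if cokernels are stable under pullback and kernels are stable under pushout. A pre-abelian category is integral if epimorphisms are stable under pullback and monomorphisms are stable under pushout. *)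

(* Defs.v *)
From HB Require Import structures.
From mathcomp Require Import all_boot all_order all_algebra.
From mathcomp Require Import boolp classical_sets functions reals.
From mathcomp Require Import complex.

Set Implicit Arguments.
Unset Strict Implicit.
Unset Printing Implicit Defensive.

Import Order.TTheory GRing.Theory Num.Theory.
Local Open Scope ring_scope.
Local Open Scope classical_set_scope.

(* The coherent choice of abelian group structures on the hom-sets is part of
   the data; in an additive category it is unique. *)
Record preadditive_category := PreadditiveCategory {
  obj :> Type;
  hom : obj -> obj -> zmodType;
  idm : forall A, hom A A;
  compm : forall A B C, hom B C -> hom A B -> hom A C;
  compm_idl : forall A B (f : hom A B), compm (idm B) f = f;
  compm_idr : forall A B (f : hom A B), compm f (idm A) = f;
  compmA : forall A B C D (h : hom C D) (g : hom B C) (f : hom A B),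
    compm h (compm g f) = compm (compm h g) f;
  compmDl : forall A B C (g g' : hom B C) (f : hom A B),
    compm (g + g') f = compm g f + compm g' f;
  compmDr : forall A B C (g : hom B C) (f f' : hom A B),
    compm g (f + f') = compm g f + compm g f'
}.

Declare Scope cat_scope.
Notation "g \oc f" := (compm g f)
  (at level 40, left associativity) : cat_scope.
Local Open Scope cat_scope.

Section Category.
Variable C : preadditive_category.

Definition is_zero_object (Z : C) : Prop :=
  forall A : C, (exists! f : hom A Z, True) /\ (exists! f : hom Z A, True).

Definition is_biproduct (A B P : C) (i1 : hom A P) (i2 : hom B P)
    (p1 : hom P A) (p2 : hom P B) : Prop :=
  [/\ p1 \oc i1 = idm A, p2 \oc i2 = idm B, p1 \oc i2 = 0, p2 \oc i1 = 0
    & i1 \oc p1 + i2 \oc p2 = idm P].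

Definition additive_category : Prop :=
  (exists Z : C, is_zero_object Z) /\
  (forall A B : C, exists (P : C) (i1 : hom A P) (i2 : hom B P)
     (p1 : hom P A) (p2 : hom P B), is_biproduct i1 i2 p1 p2).

Definition is_kernel_of (K A B : C) (k : hom K A) (f : hom A B) : Prop :=
  f \oc k = 0 /\
  forall (X : C) (h : hom X A), f \oc h = 0 -> exists! u : hom X K, k \oc u = h.

Definition is_cokernel_of (A B Q : C) (q : hom B Q) (f : hom A B) : Prop :=
  q \oc f = 0 /\
  forall (X : C) (h : hom B X), h \oc f = 0 -> exists! u : hom Q X, u \oc q = h.

Definition pre_abelian : Prop :=
  [/\ additive_category,
      (forall (A B : C) (f : hom A B),
         exists (K : C) (k : hom K A), is_kernel_of k f)
    & (forall (A B : C) (f : hom A B),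
         exists (Q : C) (q : hom B Q), is_cokernel_of q f)].

Definition morphism_class := forall A B : C, hom A B -> Prop.

Definition is_a_kernel : morphism_class :=
  fun K A k => exists (B : C) (f : hom A B), is_kernel_of k f.

Definition is_a_cokernel : morphism_class :=
  fun B Q q => exists (A : C) (f : hom A B), is_cokernel_of q f.

Definition is_mono : morphism_class :=
  fun A B f => forall (X : C) (g h : hom X A), f \oc g = f \oc h -> g = h.

Definition is_epi : morphism_class :=
  fun A B f => forall (X : C) (g h : hom B X), g \oc f = h \oc f -> g = h.

(*      a
     A ---> B
   b |      | c
     v      v
     C ---> D
        d         *)
Definition is_pullback (A B C0 D : C)
    (a : hom A B) (b : hom A C0) (c : hom B D) (d : hom C0 D) : Prop :=
  c \oc a = d \oc b /\
  forall (X : C) (f : hom X B) (g : hom X C0), c \oc f = d \oc g ->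
    exists! u : hom X A, a \oc u = f /\ b \oc u = g.

Definition is_pushout (A B C0 D : C)
    (a : hom A B) (b : hom A C0) (c : hom B D) (d : hom C0 D) : Prop :=
  c \oc a = d \oc b /\
  forall (X : C) (f : hom B X) (g : hom C0 X), f \oc a = g \oc b ->
    exists! u : hom D X, u \oc c = f /\ u \oc d = g.

Definition stable_under_pullback (P : morphism_class) : Prop :=
  forall (A B C0 D : C)
    (a : hom A B) (b : hom A C0) (c : hom B D) (d : hom C0 D),
  is_pullback a b c d -> P _ _ d -> P _ _ a.

Definition stable_under_pushout (P : morphism_class) : Prop :=
  forall (A B C0 D : C)
    (a : hom A B) (b : hom A C0) (c : hom B D) (d : hom C0 D),
  is_pushout a b c d -> P _ _ a -> P _ _ d.

Definition quasi_abelian : Prop :=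
  [/\ pre_abelian, stable_under_pullback is_a_cokernel
    & stable_under_pushout is_a_kernel].

Definition integral_category : Prop :=
  [/\ pre_abelian, stable_under_pullback is_epi
    & stable_under_pushout is_mono].

End Category.

(* The scalars form a numFieldType K, so that the definitions apply verbatim
   to R and to R[i]. In R[i] the norm takes real values, x <= y means that
   y - x is a nonnegative real, and hence 0 < l says that l is a positive
   real. *)

Section AbsolutelyConvex.
Variables (K : numFieldType) (X : lmodType K).

Definition absolutely_convex (A : set X) : Prop :=
  forall (a b : K) (x y : X), `|a| + `|b| <= 1 -> A x -> A y ->
    A (a *: x + b *: y).

Definition absolutely_convex_hull (A : set X) : set X :=
  smallest absolutely_convex A.

End AbsolutelyConvex.

HB.mixin Record isBornological (K : numFieldType) X of GRing.Lmodule K X := {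
  bornology : set (set X);
  bornology_set1 : forall x : X, bornology [set x];
  bornology_sub : forall A B : set X,
    A `<=` B -> bornology B -> bornology A;
  bornology_setU : forall A B : set X,
    bornology A -> bornology B -> bornology (A `|` B);
  bornology_scale : forall (l : K) (A : set X),
    0 < l -> bornology A -> bornology [set l *: x | x in A];
  bornology_hull : forall A : set X,
    bornology A -> bornology (absolutely_convex_hull A)
}.

#[short(type="bornoType")]
HB.structure Definition Bornological (K : numFieldType) :=
  { X of isBornological K X & GRing.Lmodule K X }.

Arguments bornology {K} s : rename.

Section BoundedLinear.
Variables (K : numFieldType) (X Y : bornoType K).

Definition bounded_map (f : X -> Y) : Prop :=
  forall B : set X, bornology X B -> bornology Y (f @` B).

Definition bounded_linear : {pred X -> Y} :=
  fun f => `[< linear f /\ bounded_map f >].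

Lemma bounded_linearP (f : X -> Y) :
  reflect (linear f /\ bounded_map f) (f \in bounded_linear).
Proof. exact: asboolP. Qed.

Lemma bounded_linear_zmod_closed : zmod_closed bounded_linear.
Proof.
split.
  apply/bounded_linearP; split.
    by move=> a x y; rewrite scaler0 addr0.
  move=> B _; apply: bornology_sub _ _ _ (bornology_set1 0).
  by move=> _ [x _ <-].
move=> f g /bounded_linearP[lf bf] /bounded_linearP[lg bg].
apply/bounded_linearP; split.
  move=> a x y; rewrite !fctE lf lg scalerBr opprD.
  by rewrite addrACA.
move=> B bB.
have bU := bornology_scale _ _ (ltr0Sn K 1)
  (bornology_hull _ (bornology_setU _ _ (bf _ bB) (bg _ bB))).
apply: bornology_sub _ _ _ bU => _ [x Bx <-].
exists (2^-1 *: f x + (- 2^-1) *: g x).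
  move=> A [cA sA]; apply: cA; last 2 first.
  - by apply: sA; left; exists x.
  - by apply: sA; right; exists x.
  rewrite normrN ger0_norm ?invr_ge0 ?ler0n //.
  by have := splitr (1 : K); rewrite !mul1r => <-.
rewrite scalerDr !scalerA mulrN divff ?pnatr_eq0 //.
by rewrite scaleN1r scale1r.
Qed.

HB.instance Definition _ := GRing.isZmodClosed.Build (X -> Y) bounded_linear
  bounded_linear_zmod_closed.

Record bornohom := BornoHom {
  bornohom_fun :> X -> Y;
  bornohomP : bornohom_fun \in bounded_linear
}.

HB.instance Definition _ := [isSub for bornohom_fun].
HB.instance Definition _ := [Equality of bornohom by <:].
HB.instance Definition _ := [Choice of bornohom by <:].
HB.instance Definition _ := [SubChoice_isSubZmodule of bornohom by <:].

Lemma bornohom_linear (f : bornohom) : linear f.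
Proof. by case/bounded_linearP: (bornohomP f). Qed.

HB.instance Definition _ (f : bornohom) :=
  GRing.isLinear.Build K X Y *:%R f (bornohom_linear f).

Lemma bornohom_bounded (f : bornohom) : bounded_map f.
Proof. by case/bounded_linearP: (bornohomP f). Qed.

Lemma bornohom_ext (f g : bornohom) : f =1 g -> f = g.
Proof. by move=> fg; apply/val_inj/funext. Qed.

Lemma bornohomDE (f g : bornohom) x : (f + g) x = f x + g x.
Proof. by []. Qed.

End BoundedLinear.

Arguments bounded_linear {K} X Y.

Lemma bornohom_id_subproof (K : numFieldType) (X : bornoType K) :
  id \in bounded_linear X X.
Proof. by apply/bounded_linearP; split=> // B; rewrite image_id. Qed.

Definition bornohom_id (K : numFieldType) (X : bornoType K) : bornohom X X :=
  BornoHom (bornohom_id_subproof X).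

Lemma bornohom_comp_subproof (K : numFieldType) (X Y Z : bornoType K)
  (g : bornohom Y Z) (f : bornohom X Y) : g \o f \in bounded_linear X Z.
Proof.
apply/bounded_linearP; split.
  by move=> a x y /=; rewrite !linearP.
move=> B /(@bornohom_bounded _ _ _ f)/(@bornohom_bounded _ _ _ g).
by rewrite image_comp.
Qed.

Definition bornohom_comp (K : numFieldType) (X Y Z : bornoType K)
    (g : bornohom Y Z) (f : bornohom X Y) : bornohom X Z :=
  BornoHom (bornohom_comp_subproof g f).

Section Bc.
Variable K : numFieldType.
Implicit Types X Y Z W : bornoType K.

Lemma bornohom_comp_idl X Y (f : bornohom X Y) :
  bornohom_comp (bornohom_id Y) f = f.
Proof. exact: bornohom_ext. Qed.

Lemma bornohom_comp_idr X Y (f : bornohom X Y) :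
  bornohom_comp f (bornohom_id X) = f.
Proof. exact: bornohom_ext. Qed.

Lemma bornohom_compA X Y Z W
    (h : bornohom Z W) (g : bornohom Y Z) (f : bornohom X Y) :
  bornohom_comp h (bornohom_comp g f) = bornohom_comp (bornohom_comp h g) f.
Proof. exact: bornohom_ext. Qed.

Lemma bornohom_compDl X Y Z (g g' : bornohom Y Z) (f : bornohom X Y) :
  bornohom_comp (g + g') f = bornohom_comp g f + bornohom_comp g' f.
Proof. exact: bornohom_ext. Qed.

Lemma bornohom_compDr X Y Z (g : bornohom Y Z) (f f' : bornohom X Y) :
  bornohom_comp g (f + f') = bornohom_comp g f + bornohom_comp g f'.
Proof. by apply: bornohom_ext => x; exact: (linearD g). Qed.

Definition Bc : preadditive_category :=
  @PreadditiveCategory (bornoType K) (fun X Y => bornohom X Y)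
    (@bornohom_id K) (@bornohom_comp K) bornohom_comp_idl bornohom_comp_idr
    bornohom_compA bornohom_compDl bornohom_compDr.

End Bc.

(* Main.v *)
(** Everything reduces to concrete descriptions of the classes of morphisms.
  Comparing a morphism with its set-theoretic kernel (with the induced
  bornology) and cokernel (the quotient, where a set is bounded iff it lies in
  the image of a bounded set), one finds that monomorphisms are the injective
  maps, epimorphisms the surjective ones, kernels the injective maps that
  reflect boundedness, and cokernels the surjective maps along which bounded
  sets lift to bounded sets.

  For a pullback of [d] along [c], the comparison map from the subspace of
  pairs [(x, y)] with [c x = d y] transports these lifting properties from [d]
  to [a].  For a pushout of [a] along [b], the comparison map to the quotient
  of [B * C0] by the pairs [(a z, - b z)] shows that if [d U] is bounded then
  [U] lies in [W - b (a^-1 V)] for bounded sets [V] and [W], and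
  [a^-1 V] is bounded when [a] is a kernel. *)

From HB Require Import structures.
From mathcomp Require Import all_boot all_algebra reals complex.
From mathcomp Require Import boolp classical_sets functions.
Require Import Defs.

Set Implicit Arguments.
Unset Strict Implicit.
Unset Printing Implicit Defensive.

Import GRing.Theory Num.Theory.
Local Open Scope ring_scope.
Local Open Scope classical_set_scope.
Local Open Scope cat_scope.

(** * Absolutely convex hulls and their images under linear maps *)

Lemma absolutely_convex_hull_convex (K : numFieldType) (X : lmodType K)
    (A : set X) (a b : K) (x y : X) : `|a| + `|b| <= 1 ->
  absolutely_convex_hull A x -> absolutely_convex_hull A y ->
  absolutely_convex_hull A (a *: x + b *: y).
Proof.
by move=> ab Ax Ay C CA; apply: CA.1 => //; [apply: Ax|apply: Ay].
Qed.

Section Hull.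
Variables (K : numFieldType) (X Y : lmodType K) (f : {linear X -> Y}).


(** The preimage of an absolutely convex set under a linear map is absolutely convex. This inclusion
    serves the bornologies of products and subspaces. *)
Lemma image_hull_sub (A : set X) :
  f @` absolutely_convex_hull A `<=` absolutely_convex_hull (f @` A).
Proof.
move=> _ [x Ax <-]; apply: (Ax (f @^-1` absolutely_convex_hull (f @` A))).
split=> [a b u v ab fu fv|u Au] /=.
  by rewrite linearD !linearZ; apply: absolutely_convex_hull_convex.
by apply: sub_gen_smallest; exists u.
Qed.

Lemma hull_image_sub (A : set X) :
  absolutely_convex_hull (f @` A) `<=` f @` absolutely_convex_hull A.
Proof.
move=> y; apply; split=> [a b _ _ ab [u Au <-] [v Av <-]|_ [u Au <-]].
  exists (a *: u + b *: v); last by rewrite linearD !linearZ.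
  exact: absolutely_convex_hull_convex.
by exists u => //; apply: sub_gen_smallest.
Qed.

End Hull.

(** * Opposites and sums of bounded sets *)

Section Bornology.
Variables (K : numFieldType) (X : bornoType K).

(** The scaling axiom covers positive scalars only; instead [- x = (-1) *: x + 0 *: x] lies in the
    hull of [A]. *)
Lemma bornologyN (A : set X) :
  bornology X A -> bornology X [set - x | x in A].
Proof.
move=> bA; apply: bornology_sub _ _ _ (bornology_hull _ bA) => _ [x Ax <-].
rewrite -[- x]addr0 -scaleN1r -[X in _ + X](scale0r x).
by apply: absolutely_convex_hull_convex;
  rewrite ?normrN ?normr1 ?normr0 ?addr0 //; apply: sub_gen_smallest.
Qed.

(** The sum [x + y] is twice the midpoint of [x] and [y], a point of the hull of the union of [A]
    and [B]. *)
Lemma bornologyD (A B : set X) : bornology X A -> bornology X B ->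
  bornology X [set x + y | x in A & y in B].
Proof.
move=> bA bB.
apply: bornology_sub _ _ _ (bornology_scale _ _ (ltr0n K 2)
  (bornology_hull _ (bornology_setU _ _ bA bB))) => _ [x Ax [y By <-]].
exists (2^-1 *: x + 2^-1 *: y); last first.
  by rewrite scalerDr !scalerA divff ?pnatr_eq0// !scale1r.
apply: absolutely_convex_hull_convex.
- rewrite ger0_norm ?invr_ge0 ?ler0n//.
  by have := splitr (1 : K); rewrite !mul1r => <-.
- by apply: sub_gen_smallest; left.
- by apply: sub_gen_smallest; right.
Qed.

End Bornology.

(** * The zero object *)

Section ZeroSpace.
Variable K : numFieldType.

(** Vectors of length zero already carry the module structure, and [flatmx0] identifies each of them
    with zero. *)
Definition zero_space := 'cV[K]_0.
HB.instance Definition _ := GRing.Lmodule.on zero_space.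
HB.instance Definition _ := @isBornological.Build K zero_space setT
  (fun=> I) (fun _ _ _ => id) (fun _ _ _ => id) (fun _ _ _ => id)
  (fun _ => id).

End ZeroSpace.

(** * Binary products *)

Section Product.
Variables (K : numFieldType) (X Y : bornoType K).

(** Equivalently, the bounded sets are the subsets of products of two bounded sets; the projections
    give a canonical pair of factors. *)
Definition product_bornology : set (set (X * Y)) :=
  [set A | bornology X (fst @` A) /\ bornology Y (snd @` A)].

Let product_set1 x : product_bornology [set x].
Proof. by split; rewrite image_set1; apply: bornology_set1. Qed.

Let product_sub A B :
  A `<=` B -> product_bornology B -> product_bornology A.
Proof.
by move=> AB [? ?]; split; (apply: bornology_sub; first exact: image_subset AB).
Qed.

Let product_setU A B : product_bornology A -> product_bornology B ->
  product_bornology (A `|` B).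
Proof.
by move=> [? ?] [? ?]; split; rewrite image_setU; apply: bornology_setU.
Qed.

Let product_scale (l : K) A : 0 < l ->
  product_bornology A -> product_bornology [set l *: x | x in A].
Proof.
move=> l0 [/(bornology_scale _ _ l0) b1 /(bornology_scale _ _ l0) b2].
by split; [apply: bornology_sub _ _ _ b1|apply: bornology_sub _ _ _ b2];
  move=> _ [_ [x Ax <-] <-] /=; [exists x.1|exists x.2] => //; exists x.
Qed.

Let product_hull A :
  product_bornology A -> product_bornology (absolutely_convex_hull A).
Proof.
move=> [/(bornology_hull _) b1 /(bornology_hull _) b2].
by split; [apply: bornology_sub _ _ _ b1|apply: bornology_sub _ _ _ b2];
  apply: image_hull_sub.
Qed.

HB.instance Definition _ := isBornological.Build K (X * Y)%type
  product_set1 product_sub product_setU product_scale product_hull.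

Lemma bornologyX (A : set X) (B : set Y) :
  bornology X A -> bornology Y B -> bornology (X * Y)%type (A `*` B).
Proof.
by move=> bA bB; split; [apply: bornology_sub _ _ _ bA|apply: bornology_sub bB];
  move=> _ [x [Ax Bx] <-].
Qed.

Definition fst_hom : bornohom (X * Y)%type X.
Proof.
by exists fst; apply/bounded_linearP; split=> // B [].
Defined.

Definition snd_hom : bornohom (X * Y)%type Y.
Proof.
by exists snd; apply/bounded_linearP; split=> // B [].
Defined.

Definition inl_hom : bornohom X (X * Y)%type.
Proof.
exists (fun x => (x, 0)); apply/bounded_linearP; split.
  by move=> a x y; congr pair => /=; rewrite scaler0 addr0.
move=> B bB; apply: bornology_sub _ _ _ (bornologyX bB (bornology_set1 0)).
by move=> _ [x Bx <-].
Defined.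

Definition inr_hom : bornohom Y (X * Y)%type.
Proof.
exists (fun y => (0, y)); apply/bounded_linearP; split.
  by move=> a x y; congr pair => /=; rewrite scaler0 addr0.
move=> B bB; apply: bornology_sub _ _ _ (bornologyX (bornology_set1 0) bB).
by move=> _ [x Bx <-].
Defined.

End Product.

(** * Subspaces with the induced bornology *)

Section Subspace.
Variables (K : numFieldType) (X : bornoType K) (S : submodClosed X).

Record subspace := Subspace { subspace_val :> X; _ : subspace_val \in S }.

HB.instance Definition _ := [isSub for subspace_val].
HB.instance Definition _ := [Equality of subspace by <:].
HB.instance Definition _ := [Choice of subspace by <:].
HB.instance Definition _ := [SubChoice_isSubLmodule of subspace by <:].

Lemma subspace_val_linear : linear subspace_val.
Proof. exact: (linearP val). Qed.

HB.instance Definition _ :=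
  GRing.isLinear.Build K subspace X *:%R subspace_val subspace_val_linear.

Definition subspace_bornology : set (set subspace) :=
  [set A | bornology X (subspace_val @` A)].

Let subspace_set1 x : subspace_bornology [set x].
Proof. by rewrite /subspace_bornology /= image_set1; apply: bornology_set1. Qed.

Let subspace_sub A B :
  A `<=` B -> subspace_bornology B -> subspace_bornology A.
Proof. by move=> AB; apply: bornology_sub; apply: image_subset. Qed.

Let subspace_setU A B : subspace_bornology A -> subspace_bornology B ->
  subspace_bornology (A `|` B).
Proof.
move=> bA bB; rewrite /subspace_bornology /= image_setU.
exact: bornology_setU.
Qed.

Let subspace_scale (l : K) A : 0 < l ->
  subspace_bornology A -> subspace_bornology [set l *: x | x in A].
Proof.
move=> l0 /(bornology_scale _ _ l0); apply: bornology_sub.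
by move=> _ [_ [x Ax <-] <-]; exists (val x); [exists x|rewrite -linearZ].
Qed.

Let subspace_hull A :
  subspace_bornology A -> subspace_bornology (absolutely_convex_hull A).
Proof.
move=> /(bornology_hull _); apply: bornology_sub.
exact: (@image_hull_sub _ _ _ subspace_val A).
Qed.

HB.instance Definition _ := isBornological.Build K subspace
  subspace_set1 subspace_sub subspace_setU subspace_scale subspace_hull.

Definition subspace_hom : bornohom subspace X.
Proof.
by exists val; apply/bounded_linearP; split=> //; apply: linearP.
Defined.

End Subspace.

(** * Quotients by the image of a morphism, with the quotient bornology *)

Section Coker.
Variables (K : numFieldType) (W X : bornoType K) (f : bornohom W X).
Local Open Scope quotient_scope.

Definition hom_image : {pred X} := fun x => `[< exists a, f a = x >].

Lemma hom_imageP x : reflect (exists a, f a = x) (x \in hom_image).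
Proof. exact: asboolP. Qed.

Lemma hom_image_submod_closed : submod_closed hom_image.
Proof.
split; first by apply/hom_imageP; exists 0; rewrite raddf0.
move=> l _ _ /hom_imageP[a <-] /hom_imageP[b <-]; apply/hom_imageP.
by exists (l *: a + b); rewrite linearP.
Qed.

HB.instance Definition _ :=
  GRing.isSubmodClosed.Build K X hom_image hom_image_submod_closed.

Definition coker_type := Quotient.quot hom_image.
HB.instance Definition _ := GRing.Zmodule.on coker_type.

Definition coker_pi (x : X) : coker_type := \pi_(Quotient.quot hom_image) x.

Lemma coker_piP (y : coker_type) : exists x, coker_pi x = y.
Proof. by exists (repr y); apply: reprK. Qed.

Lemma coker_piE x y :
  coker_pi x = coker_pi y <-> exists a, f a = x - y.
Proof.
split=> [/eqP|/hom_imageP]; first by rewrite -Quotient.idealrBE => /hom_imageP.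
by rewrite Quotient.idealrBE => /eqP.
Qed.

Lemma coker_piD : {morph coker_pi : x y / x + y}.
Proof. exact: (raddfD \pi_(Quotient.quot hom_image)). Qed.

(** Scaling acts on the chosen representative; [coker_piZ] shows that the choice is immaterial. *)
Definition coker_scale (a : K) (y : coker_type) := coker_pi (a *: repr y).

(** Two representatives of a class differ by some [f b], so their multiples by [a] differ by
    [f (a *: b)]. *)
Lemma coker_piZ a x : coker_pi (a *: x) = coker_scale a (coker_pi x).
Proof.
have /coker_piE[b fb] : coker_pi x = coker_pi (repr (coker_pi x)).
  by rewrite /coker_pi reprK.
by apply/coker_piE; exists (a *: b); rewrite linearZ /= fb scalerBr.
Qed.

Let coker_scalerA a b y :
  coker_scale a (coker_scale b y) = coker_scale (a * b) y.
Proof.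
by have [x <-] := coker_piP y; rewrite -!coker_piZ scalerA.
Qed.

Let coker_scale1r : left_id 1 coker_scale.
Proof. by move=> y; have [x <-] := coker_piP y; rewrite -coker_piZ scale1r. Qed.

Let coker_scalerDr : right_distributive coker_scale +%R.
Proof.
move=> a y y'; have [x <-] := coker_piP y; have [x' <-] := coker_piP y'.
by rewrite -coker_piD -!coker_piZ scalerDr coker_piD.
Qed.

Let coker_scalerDl y : {morph coker_scale^~ y : a b / a + b}.
Proof.
by move=> a b; have [x <-] := coker_piP y;
  rewrite -!coker_piZ scalerDl coker_piD.
Qed.

HB.instance Definition _ := GRing.Zmodule_isLmodule.Build K coker_type
  coker_scalerA coker_scale1r coker_scalerDr coker_scalerDl.

Lemma coker_pi_linear : linear coker_pi.
Proof. by move=> a x y; rewrite coker_piD coker_piZ. Qed.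

HB.instance Definition _ :=
  GRing.isLinear.Build K X coker_type *:%R coker_pi coker_pi_linear.

(** Inclusion yields the same family as equality, since [B] can be cut down to the preimage of [A],
    and makes closure under subsets immediate. *)
Definition coker_bornology : set (set coker_type) :=
  [set A | exists2 B, bornology X B & A `<=` coker_pi @` B].

Let coker_set1 y : coker_bornology [set y].
Proof.
have [x <-] := coker_piP y.
by exists [set x]; [apply: bornology_set1|rewrite image_set1].
Qed.

Let coker_sub A B :
  A `<=` B -> coker_bornology B -> coker_bornology A.
Proof. by move=> AB [C bC BC]; exists C => //; apply: subset_trans BC. Qed.

Let coker_setU A B : coker_bornology A -> coker_bornology B ->
  coker_bornology (A `|` B).
Proof.
move=> [A' bA AA'] [B' bB BB']; exists (A' `|` B'); first exact: bornology_setU.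
by rewrite image_setU; apply: setUSS.
Qed.

Let coker_bscale (l : K) A : 0 < l ->
  coker_bornology A -> coker_bornology [set l *: x | x in A].
Proof.
move=> l0 [B bB AB]; exists [set l *: x | x in B]; first exact: bornology_scale.
move=> _ [_ /AB[x Bx <-] <-]; exists (l *: x); first by exists x.
exact: linearZ.
Qed.

Let coker_hull A :
  coker_bornology A -> coker_bornology (absolutely_convex_hull A).
Proof.
move=> [B bB AB]; exists (absolutely_convex_hull B).
  exact: bornology_hull.
apply: subset_trans (@hull_image_sub _ _ _ coker_pi B).
apply: sub_smallest2r => //; exact: absolutely_convex_hull_convex.
Qed.

HB.instance Definition _ := isBornological.Build K coker_type
  coker_set1 coker_sub coker_setU coker_bscale coker_hull.

Definition coker : bornoType K := coker_type.

Definition coker_hom : bornohom X coker.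
Proof.
exists coker_pi; apply/bounded_linearP; split; first exact: linearP.
by move=> B bB; exists B.
Defined.

End Coker.

(** * Set-theoretic kernels *)

Section Ker.
Variables (K : numFieldType) (X Y : bornoType K) (f : bornohom X Y).

Definition hom_kernel : {pred X} := fun x => f x == 0.

Lemma hom_kernelP x : reflect (f x = 0) (x \in hom_kernel).
Proof. exact: eqP. Qed.

Lemma hom_kernel_submod_closed : submod_closed hom_kernel.
Proof.
split; first by apply/hom_kernelP; rewrite raddf0.
move=> l a b /hom_kernelP fa /hom_kernelP fb; apply/hom_kernelP.
by rewrite linearP /= fa fb scaler0 addr0.
Qed.

HB.instance Definition _ :=
  GRing.isSubmodClosed.Build K X hom_kernel hom_kernel_submod_closed.

Definition ker : bornoType K := subspace hom_kernel.

Definition ker_hom : bornohom ker X := subspace_hom hom_kernel.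

Lemma ker_homP (u : ker) : f (ker_hom u) = 0.
Proof. by case: u => x /= /hom_kernelP. Qed.

Lemma ker_hom_inj : injective ker_hom.
Proof. exact: val_inj. Qed.

Lemma ker_hom_surj x : f x = 0 -> exists u, ker_hom u = x.
Proof. by move=> /hom_kernelP fx; exists (Subspace fx). Qed.

Lemma bornology_ker (U : set ker) :
  bornology X (ker_hom @` U) -> bornology ker U.
Proof. by []. Qed.

End Ker.

(** * Universal properties of kernels and cokernels *)

Section BcTheory.
Variable K : numFieldType.
Local Notation C := (Bc K).
Local Notation bhom := (@bornohom K).

Lemma homP (X Y : C) (f g : hom X Y) :
  (f : bhom X Y) =1 (g : bhom X Y) <-> f = g.
Proof. by split=> [/bornohom_ext//|->]. Qed.

(** Injectivity of [k] makes the pointwise choice [u] linear. It is bounded because [k] maps [u @]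
    B[into the bounded set]h @[B]. *)
Lemma hom_lift (X Y Z : bornoType K) (k : bornohom Y Z) (h : bornohom X Z) :
  injective k -> (forall U : set Y, bornology Z (k @` U) -> bornology Y U) ->
  (forall x, exists y, k y = h x) ->
  exists u : bornohom X Y, forall x, k (u x) = h x.
Proof.
move=> kI kB /choice[u ku].
have ul : u \in bounded_linear X Y.
  apply/bounded_linearP; split=> [a x y|B bB].
    by apply: kI; rewrite linearP /= !ku linearP.
  apply: kB; apply: bornology_sub _ _ _ (bornohom_bounded h bB).
  by move=> _ [_ [x Bx <-] <-]; exists x.
by exists (BornoHom ul).
Qed.

Lemma hom_descend (X Y Z : bornoType K) (q : bornohom X Y) (h : bornohom X Z) :
  (forall y, exists x, q x = y) ->
  (forall U : set Y, bornology Y U ->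
    exists2 V, bornology X V & U `<=` q @` V) ->
  (forall x, q x = 0 -> h x = 0) ->
  exists u : bornohom Y Z, forall x, u (q x) = h x.
Proof.
move=> /choice[s qs] qB qh.
have hs x : h (s (q x)) = h x.
  apply/eqP; rewrite -subr_eq0 -raddfB; apply/eqP/qh.
  by rewrite raddfB /= qs subrr.
have ul : h \o s \in bounded_linear Y Z.
  apply/bounded_linearP; split=> [a x y /=|B /qB[V bV BV]].
    by rewrite -{1}(qs x) -{1}(qs y) -linearP hs linearP.
  apply: bornology_sub _ _ _ (bornohom_bounded h bV).
  by move=> _ [_ /BV[x Vx <-] <-]; exists x; rewrite //= hs.
by exists (BornoHom ul) => x; apply: hs.
Qed.

Lemma ker_is_kernel (X Y : C) (f : hom X Y) :
  is_kernel_of (ker_hom (f : bhom X Y) : hom (ker (f : bhom X Y) : C) X) f.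
Proof.
split; first by apply/homP => u; apply: ker_homP.
move=> Z h /homP fh.
have [|u ku] := @hom_lift Z (ker f) X (ker_hom f) h (@ker_hom_inj _ _ _ f)
  (@bornology_ker _ _ _ f).
  by move=> x; apply: ker_hom_surj; apply: fh.
exists u; split; first exact/homP.
by move=> v kv; apply/homP => x; apply: (@ker_hom_inj _ _ _ f); rewrite ku -kv.
Qed.

Lemma coker_hom_surj (X Y : bornoType K) (f : bornohom X Y) y :
  exists x, coker_hom f x = y.
Proof. exact: coker_piP. Qed.

Lemma coker_hom_eq0 (X Y : bornoType K) (f : bornohom X Y) x :
  coker_hom f x = 0 <-> exists a, f a = x.
Proof. by rewrite -(raddf0 (coker_hom f)) coker_piE subr0. Qed.

Lemma bornology_coker (X Y : bornoType K) (f : bornohom X Y)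
    (U : set (coker f)) :
  bornology (coker f) U ->
  exists2 V, bornology Y V & U `<=` coker_hom f @` V.
Proof. by []. Qed.

Lemma coker_is_cokernel (X Y : C) (f : hom X Y) :
  is_cokernel_of
    (coker_hom (f : bhom X Y) : hom Y (coker (f : bhom X Y) : C)) f.
Proof.
split; first by apply/homP => a; apply/coker_hom_eq0; exists a.
move=> Z h /homP hf.
have [|u uq] := @hom_descend Y (coker f) Z (coker_hom f) h
  (@coker_hom_surj _ _ f) (@bornology_coker _ _ f).
  by move=> x /coker_hom_eq0[a <-]; apply: hf.
exists u; split; first exact/homP.
move=> v vq; apply/homP => y; have [x <-] := @coker_hom_surj _ _ f y.
by rewrite uq -vq.
Qed.

(** * Concrete descriptions of the four classes of morphisms *)

Lemma monoP (X Y : C) (f : hom X Y) :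
  is_mono f <-> injective (f : bhom X Y).
Proof.
split=> [fm x y fxy|fI Z g h /homP fgh]; last by apply/homP => z; apply/fI/fgh.
(* The inclusion of the kernel and the zero map agree after composition with [f], so the
   monomorphism [f] forces them to be equal. *)
have k0 : ker_hom (f : bhom X Y) = 0.
  apply: (fm (ker (f : bhom X Y))).
  rewrite (ker_is_kernel f).1; apply/homP => u.
  by rewrite [RHS](raddf0 (f : bhom X Y)).
apply/eqP; rewrite -subr_eq0.
have [u <-] : exists u, ker_hom (f : bhom X Y) u = x - y.
  by apply: ker_hom_surj; rewrite raddfB /= fxy subrr.
by rewrite k0.
Qed.

(** If [f] is epi, the projection to its cokernel equals zero, as both vanish on the image of [f];
    so every class is zero and every [y] is a value of [f]. *)
Lemma epiP (X Y : C) (f : hom X Y) :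
  is_epi f <-> forall y, exists x, (f : bhom X Y) x = y.
Proof.
split=> [fe y|fS Z g h /homP ghf]; last first.
  by apply/homP => y; have [x <-] := fS y; apply: ghf.
apply/coker_hom_eq0.
have -> // : coker_hom (f : bhom X Y) = 0.
apply: (fe (coker (f : bhom X Y))).
by rewrite (coker_is_cokernel f).1; apply/homP.
Qed.

(** A kernel [k] of [f] is compared with the concrete kernel, whose properties pass to [k] through
    [u] and its retraction [v]. Conversely, such a [k] is a kernel of its own cokernel
    projection. *)
Lemma is_a_kernelP (X Y : C) (k : hom X Y) : is_a_kernel k <->
  injective (k : bhom X Y) /\
  forall U, bornology Y ((k : bhom X Y) @` U) -> bornology X U.
Proof.
split=> [[Z [f [fk kU]]]|[kI kB]].
  have [f0 fU] := ker_is_kernel f.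
  have [u [/homP uE _]] := fU _ _ fk.
  have [v [vE _]] := kU _ _ f0.
  (* Both [v \oc u] and the identity factor [k] through itself, so uniqueness equates them. *)
  have vu : v \oc u = idm X.
    have [w [_ wU]] := kU _ _ fk.
    rewrite -(wU (v \oc u)); first by apply: wU; rewrite compm_idr.
    by rewrite compmA vE; apply/homP.
  move/homP: vu => vu; split=> [x y kxy|U].
    rewrite -[LHS]vu -[RHS]vu; congr ((v : bhom _ _) _).
    by apply: (@ker_hom_inj _ _ _ (f : bhom _ _)); rewrite [LHS]uE [RHS]uE.
  move=> kUb; have bU : bornology (ker (f : bhom _ _)) ((u : bhom _ _) @` U).
    apply: bornology_ker; apply: bornology_sub _ _ _ kUb.
    by move=> _ [_ [x Ux <-] <-]; exists x => //; apply/esym/uE.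
  apply: bornology_sub _ _ _ (bornohom_bounded (v : bhom _ _) bU) => x Ux.
  by exists ((u : bhom _ _) x); [exists x|apply: vu].
exists (coker (k : bhom X Y)), (coker_hom (k : bhom X Y)).
split=> [|Z h /homP qh]; first exact: (coker_is_cokernel k).1.
have [|u uE] := @hom_lift Z X Y k h kI kB.
  by move=> x; apply/coker_hom_eq0; apply: qh.
exists u; split; first exact/homP.
by move=> v /homP vE; apply/homP => x; apply: kI; rewrite uE -vE.
Qed.

(** Dually, elements and bounded sets of [Y] are sent by [u] to the concrete cokernel, lifted to
    [X], and compared using [v \oc u = idm Y]. Conversely, such a [q] is a cokernel of its kernel
    inclusion. *)
Lemma is_a_cokernelP (X Y : C) (q : hom X Y) : is_a_cokernel q <->
  (forall y, exists x, (q : bhom X Y) x = y) /\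
  (forall U, bornology Y U ->
    exists2 V, bornology X V & U `<=` (q : bhom X Y) @` V).
Proof.
split=> [[Z [f [qf qU]]]|[qS qB]].
  have [f0 fU] := coker_is_cokernel f.
  have [u [uE _]] := qU _ _ f0.
  have [v [/homP vE _]] := fU _ _ qf.
  have vu : v \oc u = idm Y.
    have [w [_ wU]] := qU _ _ qf.
    rewrite -(wU (v \oc u)); first by apply: wU; rewrite compm_idl.
    by rewrite -compmA uE; apply/homP.
  move/homP: vu => vu; split=> [y|U bU].
    have [x xE] := coker_hom_surj ((u : bhom _ _) y).
    exists x; apply: etrans (esym (vE x)) (etrans _ (vu y)).
    by congr ((v : bhom _ _) _).
  have [V bV UV] := bornology_coker (bornohom_bounded (u : bhom _ _) bU).
  exists V => // y Uy.
  have [|x Vx xE] := UV ((u : bhom _ _) y); first by exists y.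
  exists x => //; apply: etrans (esym (vE x)) (etrans _ (vu y)).
  by congr ((v : bhom _ _) _).
exists (ker (q : bhom X Y)), (ker_hom (q : bhom X Y)).
split=> [|Z h /homP hk]; first exact: (ker_is_kernel q).1.
have [|u uE] := @hom_descend X Y Z q h qS qB.
  by move=> x /ker_hom_surj[a <-]; apply: hk.
exists u; split; first exact/homP.
move=> v /homP vE; apply/homP => y; have [x <-] := qS y.
by rewrite uE -[LHS]vE.
Qed.

(** * Zero object, biproducts, and elementwise consequences of pullbacks and pushouts *)

Lemma zero_space_is_zero : is_zero_object (zero_space K : C).
Proof.
move=> X; split; exists 0; split=> // f _; apply/homP => x.
  by rewrite [RHS]flatmx0.
rewrite (flatmx0 x); apply/esym; exact: (raddf0 (f : bhom (zero_space K) X)).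
Qed.

Lemma Bc_biproduct (X Y : C) :
  is_biproduct (inl_hom X Y : hom X ((X * Y)%type : bornoType K))
    (inr_hom X Y) (fst_hom X Y) (snd_hom X Y).
Proof.
split; apply/homP => //.
by move=> [x y]; congr pair; [apply: addr0|apply: add0r].
Qed.

(** One bounded [T] serves all pairs from [V] and [W]. Singletons then give lifting of points, and
    general bounded sets give lifting of bounded sets. *)
Lemma pullback_lift (A B C0 D : C) (a : hom A B) (b : hom A C0)
    (c : hom B D) (d : hom C0 D) (V : set B) (W : set C0) :
  is_pullback a b c d -> bornology B V -> bornology C0 W ->
  exists2 T : set A, bornology A T &
    forall x y, V x -> W y -> (c : bhom _ _) x = (d : bhom _ _) y ->
      exists2 z, T z & (a : bhom _ _) z = x.
Proof.
move=> [_ abU] bV bW.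
pose P : C := (B * C0)%type : bornoType K.
pose p1 : hom P B := fst_hom B C0; pose p2 : hom P C0 := snd_hom B C0.
(* The kernel of [m] consists of the pairs [(x, y)] with [c x = d y]; [u] below compares it with
   [A]. *)
pose m : hom P D := c \oc p1 - d \oc p2.
pose k : hom (ker m : C) P := ker_hom m.
have [|u [[/homP au _] _]] := abU _ (p1 \oc k) (p2 \oc k).
  by apply/homP => w; apply/eqP; rewrite -subr_eq0; apply/eqP/(ker_homP w).
exists ((u : bhom _ _) @` ((k : bhom _ _) @^-1` (V `*` W))).
  apply: bornohom_bounded; apply: bornology_ker.
  by apply: bornology_sub _ _ _ (bornologyX bV bW) => _ [w VWw <-].
move=> x y Vx Wy cd.
have [w wE] : exists w, (k : bhom _ _) w = (x, y).
  by apply: ker_hom_surj; apply/eqP; rewrite subr_eq0; apply/eqP.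
have VWw : (V `*` W) ((k : bhom _ _) w) by rewrite wE.
exists ((u : bhom _ _) w); first by exists w.
by rewrite [LHS]au; apply: (congr1 fst wE).
Qed.

(** The classes of [(a z, 0)] and [(0, b z)] agree because their difference is [m z]; the universal
    property of [D] then yields [u]. *)
Lemma pushout_coker (A B C0 D : C) (a : hom A B) (b : hom A C0)
    (c : hom B D) (d : hom C0 D) : is_pushout a b c d ->
  exists2 m : bhom A (B * C0)%type,
    forall z, m z = ((a : bhom _ _) z, - (b : bhom _ _) z) &
    exists u : bhom D (coker m),
      forall y, u ((d : bhom _ _) y) = coker_hom m (0, y).
Proof.
move=> [_ cdU].
pose P : C := (B * C0)%type : bornoType K.
pose i1 : hom B P := inl_hom B C0; pose i2 : hom C0 P := inr_hom B C0.
pose m : hom A P := i1 \oc a - i2 \oc b.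
exists m => [z|].
  by congr pair; [apply: subr0|apply: sub0r].
pose q : hom P (coker m : C) := coker_hom m.
have [|u [[_ /homP ud] _]] := cdU _ (q \oc i1) (q \oc i2); last by exists u.
apply/homP => z; apply/eqP; rewrite -subr_eq0; apply/eqP.
rewrite -[LHS](raddfB (q : bhom P (coker m))).
by apply/coker_hom_eq0; exists z.
Qed.

Lemma pushout_eq0 (A B C0 D : C) (a : hom A B) (b : hom A C0)
    (c : hom B D) (d : hom C0 D) y :
  is_pushout a b c d -> (d : bhom _ _) y = 0 ->
  exists2 z, (a : bhom _ _) z = 0 & y = - (b : bhom _ _) z.
Proof.
move=> /pushout_coker[m mE [u uE]] dy.
have /coker_hom_eq0[z] : coker_hom m (0, y) = 0 by rewrite -uE dy raddf0.
by rewrite mE => -[az bz]; exists z.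
Qed.

Lemma pushout_bounded (A B C0 D : C) (a : hom A B) (b : hom A C0)
    (c : hom B D) (d : hom C0 D) (U : set C0) :
  is_pushout a b c d -> bornology D ((d : bhom _ _) @` U) ->
  exists V W, [/\ bornology B V, bornology C0 W &
    forall y, U y ->
      exists2 z, V ((a : bhom _ _) z) & W (y + (b : bhom _ _) z)].
Proof.
move=> /pushout_coker[m mE [u uE]].
move=> /(bornohom_bounded u)/bornology_coker[T bT UT].
(* A representative [t] in [T] of the class of [(0, y)] satisfies [m z = (0, y) - t] for some [z].
   Hence [a z = - t.1], which explains the sign in the first set, and [y + b z = t.2]. *)
exists [set - x | x in fst @` T], (snd @` T); split.
- by apply: bornologyN; case: bT.
- by case: bT.
move=> y Uy; have [|t Tt] := UT (coker_hom m (0, y)).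
  by rewrite -uE; exists ((d : bhom _ _) y) => //; exists y.
move=> /esym/coker_piE[z]; rewrite mE => -[az bz]; exists z.
  by exists t.1; [exists t|rewrite az; apply/esym/add0r].
exists t => //; apply/eqP; rewrite -subr_eq bz.
by rewrite addrC subrK.
Qed.

Lemma bornohom_preimage (A B : C) (a : bhom A B) (V : set B) :
  (forall U, bornology B (a @` U) -> bornology A U) ->
  bornology B V -> bornology A (a @^-1` V).
Proof.
by move=> aB bV; apply: aB; apply: bornology_sub _ _ _ bV => _ [x Vx <-].
Qed.

(** * The pre-abelian, quasi-abelian and integral properties *)

Lemma Bc_pre_abelian : pre_abelian C.
Proof.
split=> [|X Y f|X Y f].
- split; first by eexists; exact: zero_space_is_zero.
  by move=> X Y; do 5 eexists; apply: Bc_biproduct.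
- by eexists; eexists; apply: ker_is_kernel.
- by eexists; eexists; apply: coker_is_cokernel.
Qed.

Lemma pullback_surjective (A B C0 D : C) (a : hom A B) (b : hom A C0)
    (c : hom B D) (d : hom C0 D) : is_pullback a b c d ->
  (forall y, exists x, (d : bhom _ _) x = y) ->
  forall y, exists x, (a : bhom _ _) x = y.
Proof.
move=> pb dS x; have [y dy] := dS ((c : bhom _ _) x).
have [T _ /(_ x y erefl erefl)[//|z _ az]] :=
  pullback_lift pb (bornology_set1 x) (bornology_set1 y).
by exists z.
Qed.

Lemma pushout_injective (A B C0 D : C) (a : hom A B) (b : hom A C0)
    (c : hom B D) (d : hom C0 D) : is_pushout a b c d ->
  injective (a : bhom _ _) -> injective (d : bhom _ _).
Proof.
move=> po aI x y dxy; apply/eqP; rewrite -subr_eq0.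
have [|z az ->] := @pushout_eq0 _ _ _ _ _ _ _ _ (x - y) po.
  by rewrite raddfB /= dxy subrr.
have -> : z = 0 by apply: aI; rewrite az raddf0.
by rewrite raddf0 oppr0.
Qed.

Lemma Bc_quasi_abelian : quasi_abelian C.
Proof.
split; first exact: Bc_pre_abelian.
  move=> A B C0 D a b c d pb /is_a_cokernelP[dS dB]; apply/is_a_cokernelP.
  split=> [|V bV]; first exact: pullback_surjective pb dS.
  (* As [d @] W[covers]c @[V], every [x] in [V] has a partner [y] in [W] with [c x = d y]. *)
  have [W bW cW] := dB _ (bornohom_bounded (c : bhom _ _) bV).
  have [T bT VT] := pullback_lift pb bV bW.
  exists T => // x Vx.
  have [|y Wy dy] := cW ((c : bhom _ _) x); first by exists x.
  by have [|z Tz az] := VT _ _ Vx Wy; [rewrite dy|exists z].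
move=> A B C0 D a b c d po /is_a_kernelP[aI aB]; apply/is_a_kernelP.
split=> [|U /(pushout_bounded po)[V [W [bV bW UVW]]]].
  exact: pushout_injective po aI.
have bA := bornohom_bounded (b : bhom _ _) (bornohom_preimage aB bV).
apply: bornology_sub _ _ _ (bornologyD bW (bornologyN bA)) => y /UVW[z Vz Wz].
exists (y + (b : bhom _ _) z) => //.
exists (- (b : bhom _ _) z); last exact: addrK.
by exists ((b : bhom _ _) z) => //; exists z.
Qed.

Lemma Bc_integral : integral_category C.
Proof.
split; first exact: Bc_pre_abelian.
  move=> A B C0 D a b c d pb /epiP dS; apply/epiP.
  exact: pullback_surjective pb dS.
move=> A B C0 D a b c d po /monoP aI; apply/monoP.
exact: pushout_injective po aI.
Qed.

End BcTheory.

Theorem theorem4p1 (R : realType) :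
  (quasi_abelian (Bc R) /\ integral_category (Bc R)) /\
  (quasi_abelian (Bc R[i]) /\ integral_category (Bc R[i])).
Proof.
by do 2 split; try exact: Bc_quasi_abelian; exact: Bc_integral.
Qed.
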